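(* Let $X$ be a Banach space and let $T:X\to X$ be a bounded linear operator. The following assertions are equivalent: (i) $T$ is Li-Yorke chaotic. (ii) $T$ admits a Li-Yorke pair. (iii) $T$ admits an irregular vector.
   Context: The metric on $X$ is $d(x,y)=\|x-y\|$. A Li-Yorke pair for $T$ is a pair of distinct points $x,y\in X$ such that $\liminf_{n\to\infty}\|T^nx-T^ny\|=0$ and $\limsup_{n\to\infty}\|T^nx-T^ny\|>0$. The operator $T$ is Li-Yorke chaotic if there is an uncountable subset $\Gamma\subset X$ such that every pair of distinct points of $\Gamma$ is a Li-Yorke pair. A vector $x\in X$ is irregular for $T$ if $\liminf_{n\to\infty}\|T^nx\|=0$ and $\limsup_{n\to\infty}\|T^nx\|=\infty$. *)

(* Defs.v *)
From mathcomp Require Import all_boot all_order all_algebra.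
From mathcomp Require Import all_classical all_reals all_analysis.
From mathcomp Require Import complex.

Set Implicit Arguments.
Unset Strict Implicit.
Unset Printing Implicit Defensive.

Import Order.TTheory GRing.Theory Num.Theory.
Import numFieldNormedType.Exports.

Local Open Scope classical_set_scope.
Local Open Scope ring_scope.

Definition bounded_operator (K : numFieldType) (X : normedModType K)
    (T : X -> X) : Prop :=
  exists M : K, forall x : X, `|T x| <= M * `|x|.

(* On a complex normed space the norm takes its values in R[i]; these are
   nonnegative reals, and taking the real part only changes their type. *)
Definition real_norm (R : realType) (X : normedModType R) (x : X) : R := `|x|.
Definition complex_norm (R : realType) (X : normedModType R[i]) (x : X) : R :=
  complex.Re `|x|.

(* The notions below take the norm as an argument [nrm : X -> R], so that they
   apply verbatim to real and to complex spaces. Lower and upper limits are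
   taken in the extended reals. *)
Section LiYorke.
Variables (R : realType) (X : zmodType) (nrm : X -> R) (T : X -> X).

Definition li_yorke_pair (x y : X) : Prop :=
  [/\ x <> y,
      limn_einf (fun n => (nrm (iter n T x - iter n T y))%:E) = 0%:E &
      (0%:E < limn_esup (fun n => (nrm (iter n T x - iter n T y))%:E))%E].

Definition li_yorke_chaotic : Prop :=
  exists Gamma : set X, ~ countable Gamma /\
    forall x y, Gamma x -> Gamma y -> x <> y -> li_yorke_pair x y.

Definition irregular_vector (x : X) : Prop :=
  limn_einf (fun n => (nrm (iter n T x))%:E) = 0%:E /\
  limn_esup (fun n => (nrm (iter n T x))%:E) = +oo%E.

End LiYorke.

(* Main.v *)
Require Import Defs.
From HB Require Import structures.
From mathcomp Require Import all_boot all_order all_algebra.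
From mathcomp Require Import all_classical all_reals all_analysis.
From mathcomp Require Import complex.
From mathcomp Require Import zify lra.

(** The step that carries the theorem is the passage from a Li-Yorke pair
    [x, y] to an irregular vector.  By linearity [u := x - y] satisfies
    liminf |T^n u| = 0 and limsup |T^n u| > 0 (it is semi-irregular).  Let Y be
    the closure of the space spanned by the orbit of [u].  If T were power
    bounded on Y, the smallness of some |T^m u| would force |T^n u| to stay
    small for all later [n]; so T is not power bounded on Y, and generic vectors
    of Y have unbounded orbits.  On the other hand a subsequence of T^n tends to
    0 at [u], hence on the whole span, so that generic vectors of Y also have
    orbits that come back arbitrarily near 0.  By the Baire category theorem
    some vector has both properties.

    The category argument is run by hand, with nested balls in X whose centres
    belong to the span of the orbit; this avoids the subspace Y as a complete
    space of its own.  Two elementary facts feed it.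
    - The span is replaced by the vectors whose orbit is [dominated] by that of
      [u], that is |T^n y| <= L |T^n u| for some L and all [n].  They are
      closed under addition, contain the multiples of every T^m u, and visibly
      inherit the small values of |T^n u| ([dominated_small]).
    - Non power boundedness is explicit: if T^m u is tiny and a later T^p u is
      larger than [delta], then a suitable multiple of T^m u is small and has a
      large image under T^(p - m) ([small_vector_large_orbit]).
    Adding such a multiple to the current centre if necessary, one shrinks the
    ball so that all its points have, at some late times, a small and a large
    iterate ([ball_of_visits]); the common point of the balls is irregular.

    Conversely, if [x] is irregular then the real multiples of [x] form an
    uncountable set in which any two distinct points are a Li-Yorke pair.

    Only real multiples of vectors are ever used.  Real and complex spaces are
    therefore treated together, as modules over a ring K that receives a ring
    morphism from R, with a real-valued complete seminorm. *)

Set Implicit Arguments.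
Unset Strict Implicit.
Unset Printing Implicit Defensive.

Import Order.TTheory GRing.Theory Num.Theory.
Import numFieldNormedType.Exports.

Local Open Scope classical_set_scope.
Local Open Scope ring_scope.

(** * Upper and lower limits of real sequences *)

Definition frequently (P : nat -> Prop) : Prop :=
  forall N, exists2 n, (N <= n)%N & P n.

Section LimitPoints.
Variables (R : realType) (a : nat -> R).

Lemma limn_esup_gt0 : (0 < limn_esup (EFin \o a))%E ->
  exists2 d, 0 < d & frequently (fun n => d < a n).
Proof.
move=> supa.
have [d d0 da] : exists2 d : R, 0 < d & (d%:E < limn_esup (EFin \o a))%E.
  move: supa; case: (limn_esup _) => [r|_|//].
    by rewrite lte_fin => r0; exists (r / 2); rewrite ?lte_fin; lra.
  by exists 1; rewrite ?ltry.
exists d => // N.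
have : (d%:E < ereal_sup [set (a n)%:E | n in [set n | (N <= n)%N]])%E.
  apply: (lt_le_trans da); apply: ereal_inf_lbound.
  by exists [set n | (N <= n)%N] => //; exists N.
by move=> /ereal_sup_gt [_ [n /= Nn <-]]; rewrite lte_fin; exists n.
Qed.

Lemma limn_esup_pinftyP :
  limn_esup (EFin \o a) = +oo%E <-> forall C, frequently (fun n => C <= a n).
Proof.
split=> [supa C N|freqa].
  have : (ereal_sup [set (a n)%:E | n in [set n | (N <= n)%N]] > C%:E)%E.
    apply: (@lt_le_trans _ _ (limn_esup (EFin \o a))); first by rewrite supa ltry.
    by apply: ereal_inf_lbound; exists [set n | (N <= n)%N] => //; exists N.
  by move=> /ereal_sup_gt [_ [n /= Nn <-]]; rewrite lte_fin => /ltW; exists n.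
apply/eqP; rewrite -leye_eq; apply: le_ereal_inf_tmp => _ [A [N _ NA] <-].
rewrite leye_eq; apply/eqP/eq_infty => C.
have [n Nn Can] := freqa C N.
apply: (@le_trans _ _ (a n)%:E); first by rewrite lee_fin.
by apply: ereal_sup_ubound; exists n => //; apply: NA.
Qed.

Lemma limn_einf_eq0P : (forall n, 0 <= a n) ->
  limn_einf (EFin \o a) = 0%E <->
  forall e, 0 < e -> frequently (fun n => a n <= e).
Proof.
move=> a0.
have -> : limn_einf (EFin \o a) =
    ereal_sup [set ereal_inf [set (a n)%:E | n in A] | A in \oo].
  exact: limf_einfE.
split=> [infa e e0 N|freqa].
  have : (ereal_inf [set (a n)%:E | n in [set n | (N <= n)%N]] < e%:E)%E.
    apply: (@le_lt_trans _ _ 0%E); last by rewrite lte_fin.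
    rewrite -infa; apply: ereal_sup_ubound.
    by exists [set n | (N <= n)%N] => //; exists N.
  by move=> /ereal_inf_lt [_ [n /= Nn <-]]; rewrite lte_fin => /ltW; exists n.
apply/eqP; rewrite eq_le; apply/andP; split.
  apply: ge_ereal_sup => _ [A [N _ NA] <-].
  apply/lee_addgt0Pr => e e0; rewrite add0e.
  have [n Nn ane] := freqa e e0 N.
  apply: (@le_trans _ _ (a n)%:E); last by rewrite lee_fin.
  by apply: ereal_inf_lbound; exists n => //; apply: NA.
apply: (@le_trans _ _ (ereal_inf [set (a n)%:E | n in setT])).
  by apply: le_ereal_inf_tmp => _ [n _ <-]; rewrite lee_fin.
by apply: ereal_sup_ubound; exists setT => //; exact: filterT.
Qed.

End LimitPoints.

(** * Orbits of linear operators for a complete seminorm *)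

Section LinearOrbits.
Variables (R : realType) (K : pzRingType) (iota : {rmorphism R -> K}).
Variables (X : lmodType K) (nrm : X -> R) (T : {linear X -> X}) (M : R).
Hypothesis nrmD : forall x y, nrm (x + y) <= nrm x + nrm y.
Hypothesis nrmZ : forall a x, nrm (iota a *: x) = `|a| * nrm x.
Hypothesis nrm_complete : forall x : nat -> X,
  (forall e, 0 < e -> exists N, forall n, (N <= n)%N -> nrm (x n - x N) <= e) ->
  exists l, forall e, 0 < e ->
    exists N, forall n, (N <= n)%N -> nrm (x n - l) <= e.
Hypothesis M_ge0 : 0 <= M.
Hypothesis nrmT : forall x, nrm (T x) <= M * nrm x.

Let nrm0 : nrm 0 = 0.
Proof. by rewrite -(scale0r (0 : X)) -(rmorph0 iota) nrmZ normr0 mul0r. Qed.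

Let nrmN x : nrm (- x) = nrm x.
Proof. by rewrite -scaleN1r -(rmorphN1 iota) nrmZ normrN1 mul1r. Qed.

Let nrm_ge0 x : 0 <= nrm x.
Proof. by have := nrmD x (- x); rewrite subrr nrm0 nrmN; lra. Qed.

Let nrmBC x y : nrm (x - y) = nrm (y - x).
Proof. by rewrite -nrmN opprB. Qed.

Let nrm_trans y x z : nrm (x - z) <= nrm (x - y) + nrm (y - z).
Proof. by have := nrmD (x - y) (y - z); rewrite addrA subrK. Qed.

Let nrm_le y x : nrm x <= nrm (x - y) + nrm y.
Proof. by have := nrmD (x - y) y; rewrite subrK. Qed.

(** Registered as a canonical structure, so that the generic lemmas on linear
    maps apply to the iterates of T. *)
Fact iter_is_linear n : linear (iter n T).
Proof. by elim: n => // n IH a x y; rewrite !iterS IH linearP. Qed.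

HB.instance Definition _ n :=
  GRing.isLinear.Build K X X _ (iter n T) (iter_is_linear n).

Lemma nrm_iter n x : nrm (iter n T x) <= M ^+ n * nrm x.
Proof.
elim: n => [|n IH]; first by rewrite expr0 mul1r.
by rewrite iterS exprS -mulrA (le_trans (nrmT _))// ler_wpM2l.
Qed.

Lemma iter_continuous n y e : 0 < e ->
  exists2 r, 0 < r &
    forall z, nrm (z - y) <= r -> nrm (iter n T z - iter n T y) <= e.
Proof.
move=> e0; have Mn0 : 0 <= M ^+ n by exact: exprn_ge0.
have c0 : 0 < M ^+ n + 1 by lra.
exists (e / (M ^+ n + 1)) => [|z zy]; first exact: divr_gt0.
rewrite -linearB (le_trans (nrm_iter _ _))//.
have : nrm (z - y) * (M ^+ n + 1) <= e by rewrite -ler_pdivlMr.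
by have := nrm_ge0 (z - y); nra.
Qed.

(** Cantor's intersection principle: the second hypothesis says that each closed
    ball lies in the preceding one, in the form given by the triangle
    inequality. *)
Lemma nested_balls (y : nat -> X) (r : nat -> R) :
  (forall k, 0 <= r k) ->
  (forall k, nrm (y k.+1 - y k) + r k.+1 <= r k) ->
  (forall e, 0 < e -> exists N, r N <= e) ->
  exists l, forall k, nrm (l - y k) <= r k.
Proof.
move=> r0 nest rsmall.
have incl k n : (k <= n)%N -> nrm (y n - y k) + r n <= r k.
  elim: n => [|n IH]; first by rewrite leqn0 => /eqP->; rewrite subrr nrm0 add0r.
  rewrite leq_eqVlt => /predU1P[->|/IH]; first by rewrite subrr nrm0 add0r.
  by have := nest n; have := nrm_trans (y n) (y n.+1) (y k); lra.
have [e e0|l lim] := @nrm_complete y.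
  have [N rN] := rsmall e e0; exists N => n /incl.
  by have := r0 n; lra.
exists l => k; apply/ler_addgt0Pr => e e0.
have [N lN] := lim e e0.
have := lN (maxn N k) (leq_maxl _ _).
have := incl k (maxn N k) (leq_maxr _ _).
have := r0 (maxn N k).
by have := nrm_trans (y (maxn N k)) l (y k); rewrite (nrmBC l (y (maxn N k))); lra.
Qed.

(** ** From a semi-irregular vector to an irregular one *)

Section SemiIrregular.
Variables (u : X) (delta : R).
Hypothesis delta_gt0 : 0 < delta.
Hypothesis u_small :
  forall e, 0 < e -> frequently (fun n => nrm (iter n T u) <= e).
Hypothesis u_large : frequently (fun n => delta < nrm (iter n T u)).

(** A convenient substitute for membership in the span of the orbit of [u]: it
    turns every time at which the orbit of [u] is small into a time at which
    the orbit of [y] is small. *)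
Definition dominated (y : X) : Prop :=
  exists2 L, 0 <= L & forall n, nrm (iter n T y) <= L * nrm (iter n T u).

(** As T^n commutes with T^m, the constant |a| M^m works for every [n]. *)
Lemma dominated_orbit a m : dominated (iota a *: iter m T u).
Proof.
exists (`|a| * M ^+ m) => [|n]; first by rewrite mulr_ge0// exprn_ge0.
rewrite linearZ/= nrmZ -mulrA ler_wpM2l//.
by rewrite -iterD addnC iterD nrm_iter.
Qed.

Lemma dominatedD y z : dominated y -> dominated z -> dominated (y + z).
Proof.
move=> [L L0 yL] [L' L'0 zL']; exists (L + L') => [|n]; first exact: addr_ge0.
by rewrite linearD/= (le_trans (nrmD _ _))// mulrDl lerD.
Qed.

Lemma dominated_small y e : dominated y -> 0 < e ->
  frequently (fun n => nrm (iter n T y) <= e).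
Proof.
move=> [L L0 yL] e0 N.
have L1 : 0 < L + 1 by lra.
have [n Nn un] := u_small (divr_gt0 e0 L1) N.
exists n => //; apply: le_trans (yL n) _.
by move: un; rewrite ler_pdivlMr//; have := nrm_ge0 (iter n T u); nra.
Qed.

(** Arbitrarily small dominated vectors reach arbitrarily large norms
    arbitrarily late: the orbit of [u] comes close to 0 at some time [m] but
    exceeds [delta] again later, at time [p], and the real factor [a] scales
    this rise so that it starts below [e] and ends above [C]. *)
Lemma small_vector_large_orbit e C N : 0 < e ->
  exists v, [/\ dominated v, nrm v <= e &
                exists2 n, (N <= n)%N & C < nrm (iter n T v)].
Proof.
move=> e0.
pose a := (`|C| + 1) / delta.
have a0 : 0 < a by rewrite divr_gt0// ltr_wpDl.
have [m _ um] := u_small (divr_gt0 e0 a0) 0.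
(* going past N + m leaves at least N steps between times m and p *)
have [p mp up] := u_large (N + m)%N.
exists (iota a *: iter m T u); split; first exact: dominated_orbit.
  by rewrite nrmZ gtr0_norm// mulrC -ler_pdivlMr.
exists (p - m)%N; first by rewrite leq_subRL; lia.
rewrite linearZ/= nrmZ -iterD subnK; last by lia.
rewrite gtr0_norm// (@lt_trans _ _ (a * delta))//; last by rewrite ltr_pM2l.
by rewrite divfK ?gt_eqF// (le_lt_trans (ler_norm _))// ltrDl.
Qed.

(** The [k]-th approximation of irregularity.  Both times are at least [k], so
    that [visits k z] for all [k] yields the lower and the upper limit. *)
Definition visits k z : Prop :=
  (exists2 n, (k <= n)%N & nrm (iter n T z) <= k.+1%:R^-1) /\
  (exists2 n, (k <= n)%N & k%:R <= nrm (iter n T z)).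

(** Density and openness in one step.  If the orbit of [y] misses the large
    value at time [n], then that of [y + v] attains it, because
    T^n v = T^n (y + v) - T^n y has norm at least twice that value.  The new
    centre is dominated, hence has a small iterate too, and the continuity of
    two iterates of T extends both inequalities, with some slack, to a ball. *)
Lemma ball_of_visits k y r : dominated y -> 0 < r ->
  exists y' r', [/\ dominated y', 0 < r', r' <= r / 2, nrm (y' - y) <= r / 2 &
    forall z, nrm (z - y') <= r' -> visits k z].
Proof.
move=> dy r0; have r20 : 0 < r / 2 by rewrite divr_gt0.
have [v [dv vr [n kn vn]]] := small_vector_large_orbit (2 * (k.+1)%:R) k r20.
have [y' [dy' y'y y'n]] : exists y', [/\ dominated y', nrm (y' - y) <= r / 2 &
    k.+1%:R <= nrm (iter n T y')].
  have [yn|yn] := lerP k.+1%:R (nrm (iter n T y)).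
    by exists y; rewrite subrr nrm0 (ltW r20).
  exists (y + v); split; [exact: dominatedD|by rewrite addrC addKr|].
  have := nrm_le (- iter n T y) (iter n T v).
  by rewrite nrmN opprK [iter n T v + _]addrC -linearD; lra.
pose c : R := k.+1%:R^-1; have e0 : 0 < c / 2 by rewrite divr_gt0// invr_gt0.
have [m km y'm] := dominated_small dy' e0 k.
have [r1 r10 cont1] := iter_continuous m y' e0.
have [r2 r200 cont2] := iter_continuous n y' ltr01.
exists y', (Num.min (r / 2) (Num.min r1 r2)); split => //.
- by rewrite !lt_min r20 r10.
- by rewrite ge_min lexx.
move=> z; rewrite !le_min => /and3P[_ zr1 zr2]; split.
  rewrite -/c; exists m => //; have := nrm_le (iter m T y') (iter m T z).
  by have := cont1 z zr1; lra.
exists n => //; have := nrm_le (iter n T z) (iter n T y').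
by have := cont2 z zr2; rewrite nrmBC; rewrite -natr1 in y'n; lra.
Qed.

(** The Baire argument: dependent choice of balls [s k], starting from the ball
    of centre 0 and radius 1. *)
Lemma exists_visits_all : exists x, forall k, visits k x.
Proof.
pose step (p : nat * (X * R)) (q : X * R) :=
  dominated p.2.1 -> 0 < p.2.2 ->
  [/\ dominated q.1, 0 < q.2, q.2 <= p.2.2 / 2, nrm (q.1 - p.2.1) <= p.2.2 / 2 &
      forall z, nrm (z - q.1) <= q.2 -> visits p.1 z].
have [f fstep] : {f | forall p, step p (f p)}.
  suff /choice[f fP] : forall p, exists q, step p q by exists f.
  move=> [k [y r]]; have [[dy r0]|ndr] := pselect (dominated y /\ 0 < r).
    by have [y' [r' ?]] := ball_of_visits k dy r0; exists (y', r').
  by exists (y, r) => dy r0; case: ndr.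
pose s := fix s k := if k is k'.+1 then f (k', s k') else (0 : X, 1 : R).
have sP k : dominated (s k).1 /\ 0 < (s k).2.
  elim: k => [|k [dk rk]]; last by have [] := fstep (k, s k) dk rk.
  by split=> //; exists 0 => // n; rewrite linear0 nrm0 mul0r.
have {}fstep k := fstep (k, s k) (sP k).1 (sP k).2.
have s_small k : (s k).2 <= k.+1%:R^-1.
  elim: k => [|k IH]; first by rewrite invr1.
  have [_ _ rk _ _] := fstep k; apply: (le_trans rk).
  apply: (@le_trans _ _ (k.+1%:R^-1 / 2)); first by rewrite ler_wpM2r.
  rewrite -invfM lef_pV2 ?posrE// -natrM ler_nat; lia.
have [||e e0|l lP] := @nested_balls (fun k => (s k).1) (fun k => (s k).2).
- by move=> k; rewrite ltW// (sP k).2.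
- by move=> k; have [_ _ rk dk _] := fstep k; rewrite /=; lra.
- exists (Num.truncn e^-1); apply: (le_trans (s_small _)).
  by rewrite invf_ple ?posrE// ltW// truncnS_gt.
by exists l => k; have [_ _ _ _] := fstep k; apply; exact: (lP k.+1).
Qed.

Lemma visits_irregular x : (forall k, visits k x) -> irregular_vector nrm T x.
Proof.
move=> vx; split.
  apply/limn_einf_eq0P => // e e0 N.
  have [[n Nn xn] _] := vx (maxn N (Num.truncn e^-1)).
  exists n; first by apply: leq_trans Nn; exact: leq_maxl.
  apply: (le_trans xn); rewrite invf_ple ?posrE//.
  apply: (le_trans (ltW (truncnS_gt _))).
  by rewrite ler_nat ltnS leq_maxr.
apply/limn_esup_pinftyP => C N.
have [_ [n Nn xn]] := vx (maxn N (Num.truncn C).+1).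
exists n; first by apply: leq_trans Nn; exact: leq_maxl.
apply: le_trans xn; apply: (le_trans (ltW (truncnS_gt _))).
by rewrite ler_nat leq_maxr.
Qed.

End SemiIrregular.

Lemma li_yorke_pair_irregular x y :
  li_yorke_pair nrm T x y -> exists z, irregular_vector nrm T z.
Proof.
move=> [_ /limn_einf_eq0P-/(_ (fun=> nrm_ge0 _)) small /limn_esup_gt0].
move=> [delta d0 large].
have iterB n : iter n T x - iter n T y = iter n T (x - y) by rewrite linearB.
have [||z /visits_irregular zirr] := @exists_visits_all (x - y) delta d0.
- by move=> e /small sm N; have [n] := sm N; exists n; rewrite // -iterB.
- by move=> N; have [n] := large N; exists n; rewrite // -iterB.
by exists z.
Qed.

(** The scrambled set is the real line through [x]: the iterates of
    [a x] and [b x] differ by |a - b| |T^n x|.  The line is uncountable because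
    a countable set of reals has Lebesgue measure 0, unlike [0, 1]. *)
Lemma irregular_li_yorke_chaotic x :
  irregular_vector nrm T x -> li_yorke_chaotic nrm T.
Proof.
move=> [/limn_einf_eq0P-/(_ (fun=> nrm_ge0 _)) small /limn_esup_pinftyP large].
have nrmB a b n : nrm (iter n T (iota a *: x) - iter n T (iota b *: x)) =
    `|a - b| * nrm (iter n T x).
  by rewrite -linearB -scalerBl -rmorphB linearZ/= nrmZ.
have inj a b : iota a *: x = iota b *: x -> a = b.
  move=> eqab; have [n _ xn] := large 1 0.
  have := nrmB a b n; rewrite eqab subrr nrm0 => /esym/eqP.
  rewrite mulf_eq0 normr_eq0 subr_eq0 => /orP[/eqP //|/eqP x0].
  by move: xn; rewrite x0 ler10.
exists [set iota a *: x | a in [set: R]]; split.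
  move=> /countable_injP[g ginj].
  have /countable_lebesgue_measure0 : countable `[0 : R, 1].
    apply/countable_injP; exists (fun a => g (iota a *: x)) => a b _ _ /ginj eqg.
    by apply: inj; apply: eqg; rewrite inE; [exists a|exists b].
  rewrite lebesgue_measure_itv /= lte_fin ltr01 sube0 => /eqP.
  by rewrite eqe oner_eq0.
move=> _ _ [a _ <-] [b _ <-] ab.
have ab0 : 0 < `|a - b|.
  by rewrite normr_gt0 subr_eq0; apply/eqP => eqab; rewrite eqab in ab.
split=> //.
  apply/limn_einf_eq0P => // e e0 N.
  have [n Nn xn] := small _ (divr_gt0 e0 ab0) N.
  by exists n => //; rewrite nrmB mulrC -ler_pdivlMr.
suff -> : limn_esup (fun n =>
  (nrm (iter n T (iota a *: x) - iter n T (iota b *: x)))%:E) = +oo%E.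
  by rewrite ltry.
apply/limn_esup_pinftyP => C N.
have [n Nn xn] := large (C / `|a - b|) N.
by exists n => //; rewrite nrmB mulrC -ler_pdivrMr.
Qed.

Theorem li_yorke_equivalences :
  [<-> li_yorke_chaotic nrm T;
       exists x y : X, li_yorke_pair nrm T x y;
       exists x : X, irregular_vector nrm T x].
Proof.
tfae=> [[Gamma [uncountable pairs]]|[x [y]]|[x]].
- have [[x [y [Gx Gy xy]]]|single] :=
    pselect (exists x y, [/\ Gamma x, Gamma y & x <> y]).
    by exists x, y; exact: pairs.
  case: uncountable; apply/countable_injP; exists (fun=> 0%N) => x y.
  rewrite !inE => Gx Gy _; apply: contrapT => xy.
  by apply: single; exists x, y.
- exact: li_yorke_pair_irregular.
- exact: irregular_li_yorke_chaotic.
Qed.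

End LinearOrbits.

(** * Real and complex Banach spaces *)

Lemma cauchy_seq_limit (K : numFieldType) (X : completeNormedModType K)
    (x : nat -> X) :
  (forall e : K, 0 < e ->
     exists N, forall n, (N <= n)%N -> `|x n - x N| <= e) ->
  exists l, forall e : K, 0 < e ->
    exists N, forall n, (N <= n)%N -> `|x n - l| <= e.
Proof.
move=> xC; have /cauchy_cvgP xcvg : cauchy (x @ \oo).
  apply/cauchyP => e e0; have [N xN] := xC (e / 2) (divr_gt0 e0 (ltr0n _ 2)).
  exists (x N); exists N => // n /= /xN xn.
  rewrite -ball_normE /= distrC (le_lt_trans xn)// ltr_pdivrMr//.
  by rewrite ltr_pMr// ltr1n.
exists (lim (x @ \oo)) => e e0.
have /cvgrPdist_le/(_ e e0)[N _ xN] := xcvg.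
by exists N => n /xN; rewrite distrC.
Qed.

(** When X = 0 the constant of a bounded operator is arbitrary, perhaps negative
    or not real, whereas the results above need a nonnegative real one. *)
Lemma bounded_operator_norm (K : numFieldType) (X : normedModType K)
    (T : X -> X) : bounded_operator T ->
  exists M : K, forall x, `|T x| <= `|M| * `|x|.
Proof.
move=> [M TM]; exists M => x.
rewrite -[`|x|]normr_id -normrM ger0_norm//.
exact: le_trans (normr_ge0 _) (TM x).
Qed.

Lemma complex_normE (R : realType) (X : normedModType R[i]) (x : X) :
  `|x| = ((complex_norm x)%:C)%C.
Proof. by rewrite /complex_norm RRe_real// ger0_real. Qed.

Lemma complex_normZ (R : realType) (X : normedModType R[i]) (a : R) (x : X) :
  complex_norm ((a%:C)%C *: x) = `|a| * complex_norm x.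
Proof.
apply: (@complexI R); rewrite rmorphM/= -!complex_normE normrZ normc_def/=.
by rewrite expr0n addr0 sqrtr_sqr.
Qed.

Lemma complex_cauchy_seq_limit (R : realType) (X : completeNormedModType R[i])
    (x : nat -> X) :
  (forall e, 0 < e -> exists N, forall n, (N <= n)%N ->
     complex_norm (x n - x N) <= e) ->
  exists l, forall e, 0 < e -> exists N, forall n, (N <= n)%N ->
    complex_norm (x n - l) <= e.
Proof.
move=> xC; have [e e0|l lP] := @cauchy_seq_limit _ X x.
  have eE : e = ((complex.Re e)%:C)%C by rewrite RRe_real// gtr0_real.
  have [|N xN] := xC (complex.Re e); first by rewrite -ltcR -eE.
  by exists N => n /xN; rewrite -lecR -eE -complex_normE.
exists l => e e0; have [|N xN] := lP ((e%:C)%C); first by rewrite ltcR.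
by exists N => n /xN; rewrite complex_normE lecR.
Qed.

Theorem theorem5 (R : realType) :
  (forall (X : completeNormedModType R) (T : {linear X -> X}),
     bounded_operator T ->
     [<-> li_yorke_chaotic (@real_norm R X) T;
          exists x y : X, li_yorke_pair (@real_norm R X) T x y;
          exists x : X, irregular_vector (@real_norm R X) T x]) /\
  (forall (X : completeNormedModType R[i]) (T : {linear X -> X}),
     bounded_operator T ->
     [<-> li_yorke_chaotic (@complex_norm R X) T;
          exists x y : X, li_yorke_pair (@complex_norm R X) T x y;
          exists x : X, irregular_vector (@complex_norm R X) T x]).
Proof.
split=> X T /bounded_operator_norm[M TM].
  apply: (@li_yorke_equivalences R R idfun X (@real_norm R X) T `|M|).
  - exact: ler_normD.
  - exact: normrZ.
  - exact: cauchy_seq_limit.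
  - by [].
  - exact: TM.
have [m m0 Mm] : exists2 m : R, 0 <= m & `|M| = ((m%:C)%C).
  have Mreal : ((complex.Re `|M|)%:C)%C = `|M| by rewrite RRe_real// normr_real.
  by exists (complex.Re `|M|) => //; rewrite -lecR Mreal normr_ge0.
apply: (@li_yorke_equivalences R R[i] (real_complex R) X (@complex_norm R X) T m).
- by move=> x y; rewrite -lecR rmorphD/= -!complex_normE ler_normD.
- exact: complex_normZ.
- exact: complex_cauchy_seq_limit.
- exact: m0.
- by move=> x; rewrite -lecR rmorphM/= -!complex_normE -Mm TM.
Qed.
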